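(* Let $m \in \mathbb{N}$ and let $\mathcal{A} : M_n(\mathbb{C}) \to M_n(\mathbb{C})$ be the linear transformation defined, for all $X \in M_n(\mathbb{C})$, by $$\mathcal{A}(X) = \sum_{j=1}^m E_j X F_j,$$ where $E_j, F_j \in M_n(\mathbb{C})$ and the families $\{E_1, E_2, \dots, E_m\}$ and $\{F_1, F_2, \dots, F_m\}$ are each linearly independent over $\mathbb{C}$. If for all $X, Y \in M_n(\mathbb{C})$ we have $$\langle \mathcal{A}(X), Y \rangle = \langle X, \mathcal{A}(Y) \rangle,$$ then there exist Hermitian matrices $A_j$ and $B_j$ in $M_n(\mathbb{C})$, for $j = 1, 2, \dots, m$ (with the same $m$), such that $$\mathcal{A}(X) = \sum_{j=1}^m A_j X B_j$$ for all $X \in M_n(\mathbb{C})$, and such that the families $\{A_1, A_2, \dots, A_m\}$ and $\{B_1, B_2, \dots, B_m\}$ are each linearly independent over $\mathbb{C}$.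
   Context: $M_n(\mathbb{C})$ is the space of $n \times n$ complex matrices, $Y^*$ is the conjugate transpose of $Y$, and $\langle X, Y \rangle = \operatorname{trace}(Y^* X)$ is the trace inner product on $M_n(\mathbb{C})$. A matrix $A$ is Hermitian if $A = A^*$. *)

(* Defs.v *)
From mathcomp Require Export all_boot all_order all_algebra.
From mathcomp Require Export reals complex.

Set Implicit Arguments.
Unset Strict Implicit.
Unset Printing Implicit Defensive.

Import GRing.Theory Num.Theory.
Local Open Scope ring_scope.
Local Open Scope sesquilinear_scope.

Definition trace_inner (C : numClosedFieldType) (n : nat) (X Y : 'M[C]_n) : C :=
  \tr (Y^t* *m X).

(* Main.v *)
Require Import Defs.
From mathcomp Require Import all_boot all_order all_algebra.
From mathcomp Require Import reals complex.

Set Implicit Arguments.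
Unset Strict Implicit.
Unset Printing Implicit Defensive.

Import GRing.Theory Num.Theory.
Local Open Scope ring_scope.

(** The map X |-> \sum_j E_j X F_j determines the tensor
    \sum_j E_j (x) F_j, so any linear functional may be contracted against
    either leg of an identity between two such sums
    ([sandwich_entries], [contract_tensor]).
    Self-adjointness says that replacing every E_j, F_j by its conjugate
    transpose does not change the map, i.e.
    \sum_j E_j (x) F_j = \sum_j E_j^* (x) F_j^*.

    Contracting the right leg with the functionals dual to the free family F
    writes each E_k as a combination of the E_j^*; hence the span V of the E_j
    is stable under conjugate transposition.  Such a V is spanned by the
    Hermitian and anti-Hermitian parts of its elements, and so has a basis
    A_1, ..., A_m of Hermitian matrices ([hermitian_basis]).  Expanding the E_j
    in that basis gives calA X = \sum_k A_k X B_k, where the B_k are obtained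
    from the F_j by an invertible change of coordinates, hence are free
    ([free_transpose_coord]).  Since the A_k are Hermitian, self-adjointness now
    reads \sum_k A_k (x) B_k = \sum_k A_k (x) B_k^*, and contracting the left
    leg with the functionals dual to A gives B_k = B_k^*. *)

(** * Bases and coordinates *)

Lemma free_subseq_span (K : fieldType) (V : vectType K) (X : seq V) :
  exists Y : seq V, [/\ {subset Y <= X}, free Y & <<Y>>%VS = <<X>>%VS].
Proof.
elim: X => [|x X [Y [sYX fY eYX]]]; first by exists [::]; rewrite nil_free.
have [xX|xX] := boolP (x \in <<X>>%VS).
  exists Y; split=> //; first by move=> y /sYX yX; rewrite inE yX orbT.
  by rewrite span_cons eYX; apply/esym/addv_idPr; rewrite -memvE.
exists (x :: Y); split; last by rewrite !span_cons eYX.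
  by move=> y; rewrite !inE => /predU1P[->|/sYX ->]; rewrite ?eqxx ?orbT.
by rewrite free_cons eYX xX.
Qed.

(** With E_j = \sum_k c_(j,k) A_k, the tensor \sum_j E_j (x) F_j equals
    \sum_k A_k (x) \sum_j c_(j,k) F_j.  The new right leg is again free because
    c has trivial kernel: a relation d between its members makes the functional
    \sum_k d_k A_k^dual vanish on every E_j, hence on every A_k. *)
Lemma free_transpose_coord (K : fieldType) (V W : vectType K) (m : nat)
    (A E : m.-tuple V) (F : m.-tuple W) :
  free A -> {subset A <= <<E>>%VS} -> free F ->
  free [tuple \sum_(j < m) coord A k E`_j *: F`_j | k < m].
Proof.
move=> fA sAE /freeP fF; apply/freeP=> d.
under eq_bigr => k _ do
  rewrite -(tnth_nth _ _ k) tnth_mktuple scaler_sumr.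
rewrite exchange_big /=.
under eq_bigr => j _ do
  [under eq_bigr => k _ do rewrite scalerA; rewrite -scaler_suml].
move=> /fF d0 k.
have AkE : A`_k \in <<E>>%VS by apply/sAE/mem_nth; rewrite size_tuple.
have : \sum_i d i * coord A i A`_k = 0.
  rewrite (coord_span AkE).
  under eq_bigr => i _ do rewrite linear_sum mulr_sumr.
  rewrite exchange_big /= big1 // => j _.
  under eq_bigr => i _ do rewrite linearZ /= mulrCA.
  by rewrite -mulr_sumr d0 mulr0.
rewrite (bigD1 k) //= coord_free // eqxx mulr1 big1 ?addr0 // => i ik.
by rewrite coord_free // eq_sym (negPf ik) mulr0.
Qed.

(** * Sums of two-sided multiplications as tensors *)

(** Evaluating at the matrix units reads off the coefficients of the tensor. *)
Lemma sandwich_entries (K : comNzRingType) (m p q r s : nat)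
    (E G : 'I_m -> 'M[K]_(p, q)) (F H : 'I_m -> 'M[K]_(r, s)) :
  (forall X : 'M[K]_(q, r),
     \sum_j E j *m X *m F j = \sum_j G j *m X *m H j) ->
  forall i a b l,
    \sum_j E j i a * F j b l = \sum_j G j i a * H j b l.
Proof.
have entry (P : 'M[K]_(p, q)) (Q : 'M[K]_(r, s)) i a b l :
    (P *m delta_mx a b *m Q) i l = P i a * Q b l.
  rewrite mxE (bigD1 b) //= big1 ?addr0 => [|c cb].
    rewrite mxE (bigD1 a) //= big1 ?addr0 => [|c ca].
      by rewrite mxE !eqxx mulr1.
    by rewrite mxE (negPf ca) mulr0.
  rewrite mxE big1 ?mul0r // => e _.
  by rewrite mxE (negPf cb) andbF mulr0.
move=> EFGH i a b l.
have := congr1 (fun M : 'M_(p, s) => M i l) (EFGH (delta_mx a b)).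
by rewrite !summxE; under eq_bigr do rewrite entry;
  under [in RHS]eq_bigr do rewrite entry.
Qed.

Lemma contract_tensor (K : fieldType) (m p q r s : nat)
    (E G : 'I_m -> 'M[K]_(p, q)) (F H : 'I_m -> 'M[K]_(r, s)) :
  (forall i a b l, \sum_j E j i a * F j b l = \sum_j G j i a * H j b l) ->
  forall phi : {scalar 'M[K]_(p, q)},
    \sum_j phi (E j) *: F j = \sum_j phi (G j) *: H j.
Proof.
move=> EFGH phi; apply/matrixP=> b l; rewrite !summxE.
have expand (P : 'I_m -> 'M[K]_(p, q)) (Q : 'I_m -> 'M[K]_(r, s)) :
    \sum_j (phi (P j) *: Q j) b l =
    \sum_i \sum_a phi (delta_mx i a) * \sum_j P j i a * Q j b l.
  transitivity (\sum_j \sum_i \sum_a phi (delta_mx i a) * (P j i a * Q j b l)).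
    apply: eq_bigr => j _.
    rewrite mxE {1}[P j]matrix_sum_delta linear_sum mulr_suml.
    apply: eq_bigr => i _; rewrite linear_sum mulr_suml.
    by apply: eq_bigr => a _; rewrite linearZ /= mulrAC mulrC.
  rewrite exchange_big; apply: eq_bigr => i _.
  by rewrite exchange_big; apply: eq_bigr => a _; rewrite mulr_sumr.
rewrite !expand; apply: eq_bigr => i _; apply: eq_bigr => a _.
by rewrite EFGH.
Qed.

(** * Conjugate transposition *)

Section ConjugateTranspose.
Local Open Scope sesquilinear_scope.
Variables (C : numClosedFieldType) (n : nat).
Implicit Types M N : 'M[C]_n.

Lemma trmxC_mul M N : (M *m N)^t* = N^t* *m M^t*.
Proof. by rewrite trmx_mul map_mxM. Qed.

Lemma trmxCD M N : (M + N)^t* = M^t* + N^t*.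
Proof. by rewrite linearD map_mxD. Qed.

Lemma trmxCN M : (- M)^t* = - M^t*.
Proof. by rewrite linearN map_mxN. Qed.

Lemma trmxCZ (a : C) M : (a *: M)^t* = a^* *: M^t*.
Proof. by rewrite linearZ map_mxZ. Qed.

Lemma trmxC_sum (I : finType) (M : I -> 'M[C]_n) :
  (\sum_i M i)^t* = \sum_i (M i)^t*.
Proof. by rewrite linear_sum map_mx_sum. Qed.

Lemma hermsymmxP M : reflect (M^t* = M) (M \is hermsymmx).
Proof. by rewrite is_hermitianmxE expr0 scale1r eq_sym; apply: eqP. Qed.

(** M = 1/2 ((M + M^* ) - i (i (M - M^* ))), so the Hermitian matrices M + M^*
    and i (M - M^* ) attached to the elements of X span the same space as X. *)
Lemma hermitian_basis (X : seq 'M[C]_n) :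
  {in X, forall M, M^t* \in <<X>>%VS} ->
  exists2 Y, {in Y, forall M, M \is hermsymmx} & basis_of <<X>> Y.
Proof.
move=> starX.
pose re M := M + M^t*; pose im M := 'i *: (M - M^t*).
have re_herm M : re M \is hermsymmx.
  by apply/hermsymmxP; rewrite trmxCD trmxCK addrC.
have im_herm M : im M \is hermsymmx.
  apply/hermsymmxP; rewrite trmxCZ trmxCD trmxCN trmxCK conjCi.
  by rewrite scaleNr -scalerN opprB.
have [Y [sY fY eY]] :=
  free_subseq_span ([seq re M | M <- X] ++ [seq im M | M <- X]).
exists Y.
  by move=> M /sY; rewrite mem_cat => /orP[] /mapP[N _ ->].
rewrite /basis_of fY andbT eY eqEsubv; apply/andP; split; apply/span_subvP => M.
  rewrite mem_cat => /orP[] /mapP[N NX ->].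
    by rewrite memvD ?starX ?memv_span.
  by rewrite memvZ ?memvB ?starX ?memv_span.
move=> MX.
have -> : M = 2^-1 *: (re M - 'i *: im M).
  rewrite scalerA -expr2 sqrCi scaleN1r opprK addrACA subrr addr0.
  by rewrite -mulr2n -scaler_nat scalerA mulVf ?scale1r ?pnatr_eq0.
apply/memvZ/memvB; last apply: memvZ; apply: memv_span; rewrite mem_cat.
  by rewrite (map_f re MX).
by rewrite (map_f im MX) orbT.
Qed.

(** The adjoint of X |-> \sum_j E_j X F_j for the trace inner product is
    X |-> \sum_j E_j^* X F_j^*, by cyclicity of the trace. *)
Lemma selfadjoint_sandwich (m : nat) (E F : 'I_m -> 'M[C]_n)
    (calA : 'M[C]_n -> 'M[C]_n) :
  (forall X, calA X = \sum_j E j *m X *m F j) ->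
  (forall X Y, trace_inner (calA X) Y = trace_inner X (calA Y)) ->
  forall X, calA X = \sum_j (E j)^t* *m X *m (F j)^t*.
Proof.
move=> calAE selfadj X; set Z := RHS.
have trE Y : trace_inner (calA X) Y = trace_inner Z Y.
  rewrite selfadj /trace_inner calAE /Z trmxC_sum mulmx_suml mulmx_sumr.
  rewrite !raddf_sum /=; apply: eq_bigr => j _.
  by rewrite !trmxC_mul -!mulmxA mxtrace_mulC !mulmxA.
(* Pairing with a matrix unit extracts one entry. *)
apply/matrixP=> i k; have := trE (delta_mx i k).
suff tr_delta (M : 'M[C]_n) : trace_inner M (delta_mx i k) = M i k.
  by rewrite !tr_delta.
rewrite /trace_inner trmx_delta map_delta_mx mxtrace_mulC /mxtrace.
rewrite (bigD1 i) //= big1 ?addr0 => [|j ji].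
  rewrite mxE (bigD1 k) //= big1 ?addr0 => [|l lk].
    by rewrite mxE !eqxx mulr1.
  by rewrite mxE (negPf lk) mulr0.
by rewrite mxE big1 // => l _; rewrite mxE (negPf ji) andbF mulr0.
Qed.

End ConjugateTranspose.

Theorem theorem3p2 (R : realType) (n m : nat)
    (E F : 'I_m -> 'M[complex R]_n)
    (calA : {linear 'M[complex R]_n -> 'M[complex R]_n})
    (calA_def : forall X : 'M[complex R]_n,
       calA X = \sum_(j < m) E j *m X *m F j)
    (E_free : free [tuple E j | j < m])
    (F_free : free [tuple F j | j < m])
    (calA_selfadjoint : forall X Y : 'M[complex R]_n,
       trace_inner (calA X) Y = trace_inner X (calA Y)) :
  exists A B : 'I_m -> 'M[complex R]_n,
    [/\ forall j : 'I_m, A j \is hermsymmx,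
        forall j : 'I_m, B j \is hermsymmx,
        forall X : 'M[complex R]_n, calA X = \sum_(j < m) A j *m X *m B j,
        free [tuple A j | j < m]
      & free [tuple B j | j < m]].
Proof.
set tE := [tuple E j | j < m] in E_free.
set tF := [tuple F j | j < m] in F_free.
have tEE (j : 'I_m) : tE`_j = E j by rewrite -tnth_nth tnth_mktuple.
have tFE (j : 'I_m) : tF`_j = F j by rewrite -tnth_nth tnth_mktuple.
have adj := selfadjoint_sandwich calA_def calA_selfadjoint.
(* Contracting E_j (x) F_j against the k-th dual vector of F isolates E_k. *)
have starE : {in tE, forall M, (M^t*)%sesqui \in <<tE>>%VS}.
  move=> _ /tnthP[k ->]; rewrite tnth_mktuple.
  have FE i a b l : \sum_j F j i a * E j b l =
      \sum_j ((F j)^t*)%sesqui i a * ((E j)^t*)%sesqui b l.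
    under eq_bigr do rewrite mulrC; under [in RHS]eq_bigr do rewrite mulrC.
    by apply: sandwich_entries => X; rewrite -calA_def adj.
  have := contract_tensor FE (coord tF k).
  rewrite (bigD1 k) //= -tFE coord_free // eqxx scale1r big1 ?addr0 => [->|j jk].
    rewrite trmxC_sum; apply: memv_suml => j _; rewrite trmxCZ trmxCK.
    by rewrite -tEE; apply/memvZ/memv_span/mem_nth; rewrite size_tuple.
  by rewrite -tFE coord_free // (negPf jk) scale0r.
have [Y hermY /andP[/eqP spanY freeY]] := hermitian_basis starE.
have sizeY : size Y == m.
  move: freeY E_free; rewrite /free spanY => /eqP <- /eqP ->.
  by rewrite size_tuple.
pose tA : m.-tuple 'M[complex R]_n := Tuple sizeY.
pose B k := \sum_(j < m) coord tA k (E j) *: F j.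
have calA_B X : calA X = \sum_(k < m) tA`_k *m X *m B k.
  rewrite calA_def.
  under [in RHS]eq_bigr => k _ do rewrite mulmx_sumr.
  rewrite exchange_big; apply: eq_bigr => j _.
  have Ej : E j \in <<tA>>%VS.
    by rewrite spanY -tEE memv_span // mem_nth ?size_tuple.
  rewrite {1}(coord_span Ej) !mulmx_suml; apply: eq_bigr => k _.
  by rewrite -!scalemxAl -scalemxAr.
have hermA (k : 'I_m) : tA`_k \is hermsymmx.
  by apply/hermY/mem_nth; rewrite (eqP sizeY).
have tAE : [tuple tA`_k | k < m] = tA.
  by apply: eq_from_tnth => k; rewrite tnth_mktuple -tnth_nth.
exists (fun k => tA`_k), B; split=> // [k||].
- have AB i a b l : \sum_(j < m) tA`_j i a * B j b l =
      \sum_(j < m) tA`_j i a * ((B j)^t*)%sesqui b l.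
    apply: sandwich_entries => X; rewrite -calA_B.
    rewrite (selfadjoint_sandwich calA_B calA_selfadjoint).
    by apply: eq_bigr => j _; rewrite (hermsymmxP _ (hermA j)).
  apply/hermsymmxP; have := contract_tensor AB (coord tA k).
  have isolate (G : 'I_m -> 'M[complex R]_n) :
      \sum_(j < m) coord tA k tA`_j *: G j = G k.
    rewrite (bigD1 k) //= coord_free // eqxx scale1r big1 ?addr0 // => j jk.
    by rewrite coord_free // (negPf jk) scale0r.
  by rewrite !isolate.
- by rewrite tAE.
- have := @free_transpose_coord _ _ _ _ tA tE tF freeY _ F_free.
  under eq_mktuple => k do under eq_bigr => j _ do rewrite tEE tFE.
  by apply=> M MA; rewrite -spanY memv_span.
Qed.
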